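(* For every odd integer $n\geq 1$, there exists a globally simple $\mathrm{N}\mathrm{H}_{2n^2}(n;n)$.
   Context: Let $n,t\ge 1$ be integers with $t$ dividing $2n^2$, let $v=2n^2+t$, and let $J$ be the subgroup of $\mathbb{Z}_v$ of order $t$. A (square, tight, relative) non-zero sum Heffter array $\mathrm{N}\mathrm{H}_t(n;n)$ is an $n\times n$ array $A$ with no empty cells and with entries in $\mathbb{Z}_v$ such that: (i) the multiset $\{\pm x \mid x\in A\}$ contains each element of $\mathbb{Z}_v\setminus J$ exactly once (and no other element); (ii) the sum of the elements in every row and in every column is different from $0$ in $\mathbb{Z}_v$. An ordering $(t_1,\dots,t_k)$ of a finite list of elements of an abelian group is simple if its partial sums $s_i=\sum_{j=1}^i t_j$, $i=1,\dots,k$, are all non-zero and pairwise distinct. A natural ordering of a row (respectively column) is the ordering of its entries read cyclically from left to right (respectively from top to bottom) starting from some chosen entry. The array is globally simple if each row and each column admits at least one natural ordering that is simple. *)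

(* Defs.v *)
From HB Require Import structures.
From mathcomp Require Import all_boot all_order all_algebra all_fingroup.

Set Implicit Arguments.
Unset Strict Implicit.
Unset Printing Implicit Defensive.

Import GRing.Theory.

Local Open Scope ring_scope.

Definition heffter_modulus (n t : nat) : nat := (2 * n ^ 2 + t)%N.

Definition row_seq (V : Type) (n : nat) (A : 'M[V]_n) (i : 'I_n) : seq V :=
  [seq A i j | j <- enum 'I_n].

Definition col_seq (V : Type) (n : nat) (A : 'M[V]_n) (j : 'I_n) : seq V :=
  [seq A i j | i <- enum 'I_n].

Definition entries (V : Type) (n : nat) (A : 'M[V]_n) : seq V :=
  [seq A p.1 p.2 | p <- enum {: 'I_n * 'I_n}].

Definition partial_sums (V : zmodType) (s : seq V) : seq V :=
  [seq \sum_(x <- take i s) x | i <- iota 1 (size s)].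

Definition simple_ordering (V : zmodType) (s : seq V) : Prop :=
  0 \notin partial_sums s /\ uniq (partial_sums s).

(* Cyclic readings are the rotations: [rot k s] starts at the entry of index
   [k] of [s]. *)
Definition has_simple_natural_ordering (V : zmodType) (s : seq V) : Prop :=
  exists2 k : nat, (k < size s)%N & simple_ordering (rot k s).

Definition globally_simple (V : zmodType) (n : nat) (A : 'M[V]_n) : Prop :=
  (forall i : 'I_n, has_simple_natural_ordering (row_seq A i)) /\
  (forall j : 'I_n, has_simple_natural_ordering (col_seq A j)).

(* [J] is determined by its order, since 'Z_v is cyclic.  The positivity of [n]
   and [t] makes the modulus at least 3, so that 'Z_v is indeed Z/vZ.  Both [x]
   and [- x] are listed for every cell, so [perm_eq] counts multiplicities. *)
Definition is_NH (n t : nat) (A : 'M['Z_(heffter_modulus n t)]_n) : Prop :=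
  [/\ (0 < n)%N, (0 < t)%N, (t %| 2 * n ^ 2)%N
    & exists J : {group 'Z_(heffter_modulus n t)},
      [/\ #|J| = t,
          perm_eq (entries A ++ [seq - x | x <- entries A]) (enum (~: J)),
          (forall i : 'I_n, \sum_j A i j != 0)
        & (forall j : 'I_n, \sum_i A i j != 0)]].

Arguments is_NH n t A : clear implicits.

(* Main.v *)
(* Fill the n x n array row by row with 1, 3, ..., 2n^2 - 1 and sign it like a
   checkerboard. Every row and column is then an alternating arithmetic
   progression, whose partial sums have absolute values growing linearly and
   staying below 2n^2; since v = 4n^2, nothing wraps around. *)

Require Import Defs.
From mathcomp Require Import all_boot all_order all_algebra all_fingroup.
From mathcomp Require Import zify.

Set Implicit Arguments.
Unset Strict Implicit.
Unset Printing Implicit Defensive.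

Import GRing.Theory.

Local Open Scope ring_scope.

(** * Signed residues of small absolute value *)

Lemma natr_Zp_inj (v a b : nat) : (1 < v)%N -> (a < v)%N -> (b < v)%N ->
  a%:R = b%:R :> 'Z_v -> a = b.
Proof.
move=> v_gt1 ltav ltbv /(congr1 val) /=.
by rewrite !val_Zp_nat // !modn_small.
Qed.

(** Two positive integers below v/2 add up to less than v, so neither is congruent to the opposite
    of the other: the residue determines both sign and absolute value. *)
Lemma signed_natr_Zp_inj (v s t a b : nat) :
  (0 < a)%N -> (0 < b)%N -> (a.*2 < v)%N -> (b.*2 < v)%N ->
  (-1) ^+ s * a%:R = (-1) ^+ t * b%:R :> 'Z_v -> odd s = odd t /\ a = b.
Proof.
move=> a_gt0 b_gt0 ltav ltbv.
have v_gt1 : (1 < v)%N by lia.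
have opp_neq x y : (0 < x)%N -> (x.*2 < v)%N -> (y.*2 < v)%N ->
    x%:R <> - y%:R :> 'Z_v.
  move=> x_gt0 ltxv ltyv /eqP; rewrite -addr_eq0 -natrD => /eqP xy0.
  have : (x + y = 0)%N by apply: (@natr_Zp_inj v) => //; lia.
  lia.
rewrite -(signr_odd _ s) -(signr_odd _ t).
case: (odd s) (odd t) => [] []; rewrite ?expr1 ?expr0 ?mul1r ?mulN1r.
- by move=> /oppr_inj /natr_Zp_inj ->; lia.
- by move=> /esym /opp_neq; case.
- by move=> /opp_neq; case.
- by move=> /natr_Zp_inj ->; lia.
Qed.

Lemma signed_natr_Zp_neq0 (v s a : nat) :
  (0 < a)%N -> (a < v)%N -> (-1) ^+ s * a%:R != 0 :> 'Z_v.
Proof.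
move=> a_gt0 ltav; have v_gt1 : (1 < v)%N by lia.
rewrite -signr_odd mulr_sign; suff: a%:R != 0 :> 'Z_v.
  by case: (odd s); rewrite ?oppr_eq0.
by apply/eqP => /(@natr_Zp_inj v a 0); lia.
Qed.

(** * Alternating arithmetic progressions *)

Definition alt_term (V : pzRingType) (c a d k : nat) : V :=
  (-1) ^+ (c + k) * (a + d.*2 * k)%:R.

(** Absolute value of the m-th partial sum over the integers: each pair of consecutive terms
    contributes 2d, and for odd m the first term a stays unpaired. *)
Definition alt_sum (a d m : nat) : nat := (odd m * a + d.*2 * m./2)%N.

Lemma sum_alt_term (V : pzRingType) (c a d m : nat) :
  \sum_(0 <= k < m) alt_term V c a d k =
  (-1) ^+ (c + m.+1) * (alt_sum a d m)%:R.
Proof.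
elim: m => [|m IHm]; first by rewrite big_nil /alt_sum muln0 mulr0.
(* Successive partial sums have opposite signs, so the term between them has the sum of their
   absolute values as its own. *)
have step : (a + d.*2 * m = alt_sum a d m.+1 + alt_sum a d m)%N.
  by rewrite /alt_sum /= uphalf_half; have := odd_double_half m; nia.
rewrite big_nat_recr //= IHm /alt_term step natrD mulrDr !addnS !exprS.
by rewrite !mulN1r opprK !mulNr addrCA addNr addr0.
Qed.

Section AlternatingProgression.

Variables (v a d n : nat).
Hypotheses (a_odd : odd a) (d_gt0 : (0 < d)%N).
Hypothesis last_small : ((a + d.*2 * n.-1).*2 < v)%N.

(** A partial sum never exceeds its last summand a + 2d(m-1) in absolute value, and [last_small]
    keeps that below v/2. *)
Lemma alt_sum_bounds m : (0 < m <= n)%N ->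
  (0 < alt_sum a d m)%N /\ ((alt_sum a d m).*2 < v)%N.
Proof.
rewrite /alt_sum => m_bounds; have := odd_double_half m.
case: (odd m) => /= m_eq; split; nia.
Qed.

(** As a is odd, the parity of m can be read off [alt_sum a d m]; then d > 0 gives back [m./2]. *)
Lemma alt_sum_inj : injective (alt_sum a d).
Proof.
move=> m p eq_mp; have := congr1 odd eq_mp.
rewrite /alt_sum !oddD !oddM !odd_double !andFb !addbF !oddb a_odd !andbT.
move=> eq_odd; move: eq_mp; rewrite /alt_sum eq_odd => /addnI/eqP.
rewrite eqn_pmul2l ?double_gt0 // => /eqP eq_half.
by rewrite -(odd_double_half m) eq_odd eq_half odd_double_half.
Qed.

Lemma alt_sum_neq0 c m : (0 < m <= n)%N ->
  \sum_(0 <= k < m) alt_term 'Z_v c a d k != 0.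
Proof.
move=> /alt_sum_bounds [gt0 small]; rewrite sum_alt_term.
by apply: signed_natr_Zp_neq0 => //; lia.
Qed.

(** The absolute values, distinct and strictly between 0 and v/2, already separate the partial sums,
    whatever their signs. *)
Lemma alt_simple c :
  simple_ordering [seq alt_term 'Z_v c a d k | k <- iota 0 n].
Proof.
have sums : partial_sums [seq alt_term 'Z_v c a d k | k <- iota 0 n] =
    [seq \sum_(0 <= k < m) alt_term 'Z_v c a d k | m <- iota 1 n].
  rewrite /partial_sums size_map size_iota; apply/eq_in_map => m.
  rewrite mem_iota => m_bounds; rewrite -map_take take_iota big_map.
  by rewrite /index_iota subn0 (minn_idPl _) //; lia.
rewrite /simple_ordering sums; split.
  apply/mapP => -[m]; rewrite mem_iota => m_bounds /esym/eqP.
  by apply/negP/alt_sum_neq0; lia.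
rewrite map_inj_in_uniq ?iota_uniq // => m p.
rewrite !mem_iota !sum_alt_term => m_bounds p_bounds.
have [m_gt0 m_small] : _ /\ _ := @alt_sum_bounds m ltac:(lia).
have [p_gt0 p_small] : _ /\ _ := @alt_sum_bounds p ltac:(lia).
by case/signed_natr_Zp_inj => // _ /alt_sum_inj.
Qed.

End AlternatingProgression.

(** * The array, its lines and its entries *)

Definition checkerboard (n v : nat) : 'M['Z_v]_n :=
  \matrix_(i, j) ((-1) ^+ (i + j) * (n * i + j).*2.+1%:R).

Section Checkerboard.

Variables (n v : nat).
Hypothesis v_eq : v = (4 * n ^ 2)%N.

Lemma checkerboard_row i j :
  checkerboard n v i j = alt_term 'Z_v i (n * i).*2.+1 1 j.
Proof. by rewrite mxE /alt_term; congr (_ * _%:R); lia. Qed.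

Lemma checkerboard_col i j :
  checkerboard n v i j = alt_term 'Z_v j j.*2.+1 n i.
Proof.
by rewrite mxE /alt_term addnC; congr (_ * _%:R); nia.
Qed.

(** The row ends with absolute value 2n(i+1) - 1, at most 2n^2 - 1, while v/2 = 2n^2. *)
Lemma row_last_small (i : 'I_n) : (((n * i).*2.+1 + 1.*2 * n.-1).*2 < v)%N.
Proof. by have := ltn_ord i; rewrite v_eq; nia. Qed.

Lemma col_last_small (j : 'I_n) : ((j.*2.+1 + n.*2 * n.-1).*2 < v)%N.
Proof. by have := ltn_ord j; rewrite v_eq; nia. Qed.

Lemma checkerboard_row_sum i : \sum_j checkerboard n v i j != 0.
Proof.
under eq_bigr do rewrite checkerboard_row.
rewrite -(big_mkord xpredT (alt_term _ _ _ _)).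
by apply: alt_sum_neq0 (row_last_small i) _ _ _ => //=; have := ltn_ord i; lia.
Qed.

Lemma checkerboard_col_sum j : \sum_i checkerboard n v i j != 0.
Proof.
under eq_bigr do rewrite checkerboard_col.
rewrite -(big_mkord xpredT (alt_term _ _ _ _)).
by apply: alt_sum_neq0 (col_last_small j) _ _ _ => //=; have := ltn_ord j; lia.
Qed.

Lemma checkerboard_globally_simple : globally_simple (checkerboard n v).
Proof.
(* The reading that starts at the first entry is already simple. *)
split=> [i | j]; exists 0%N.
- by rewrite size_map size_enum_ord; have := ltn_ord i; lia.
- rewrite rot0 /row_seq (eq_map (checkerboard_row i)).
  rewrite (map_comp (alt_term _ _ _ _) val) val_enum_ord.
  by apply: alt_simple (row_last_small i) _; rewrite //= odd_double.
- by rewrite size_map size_enum_ord; have := ltn_ord j; lia.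
- rewrite rot0 /col_seq (eq_map (checkerboard_col ^~ j)).
  rewrite (map_comp (alt_term _ _ _ _) val) val_enum_ord.
  apply: alt_simple (col_last_small j) _; rewrite /= ?odd_double //.
  by have := ltn_ord j; lia.
Qed.

(** Exponents 0 and 1 select x and -x, so this covers both repeated entries and an entry equal to
    the opposite of another. *)
Lemma checkerboard_signed_inj (s t : nat) (p q : 'I_n * 'I_n) :
  (-1) ^+ s * checkerboard n v p.1 p.2 = (-1) ^+ t * checkerboard n v q.1 q.2 ->
  odd s = odd t /\ p = q.
Proof.
case: p q => [i j] [k l] /=; rewrite !mxE !mulrA -!exprD.
have := ltn_ord i; have := ltn_ord j; have := ltn_ord k; have := ltn_ord l.
move=> l_lt k_lt j_lt i_lt.
case/signed_natr_Zp_inj; rewrite ?v_eq //; try nia.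
move=> eq_odd [/double_inj eq_pos].
(* The position ni + j is a base-n expansion with last digit j < n, so division by n recovers the
   row. *)
have eq_ik : i = k :> nat.
  have := congr1 (divn^~ n) eq_pos.
  by rewrite !(mulnC n) !divnMDl ?divn_small ?addn0 //; lia.
have eq_jl : j = l :> nat by move: eq_pos; rewrite eq_ik => /addnI.
split; last by congr pair; apply: val_inj.
by move: eq_odd; rewrite eq_ik eq_jl !oddD => /addIb.
Qed.

Lemma checkerboard_signed_entries_uniq :
  uniq (entries (checkerboard n v) ++
        [seq - x | x <- entries (checkerboard n v)]).
Proof.
have entries_uniq : uniq (entries (checkerboard n v)).
  rewrite map_inj_uniq ?enum_uniq // => p q eq_pq.
  by have [|_ ->] // := @checkerboard_signed_inj 0 0 p q; rewrite eq_pq.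
rewrite cat_uniq entries_uniq (map_inj_uniq oppr_inj) entries_uniq andbT.
apply/hasPn => _ /mapP[_ /mapP[q _ ->] ->]; apply/mapP => -[p _ eq_qp].
have [] // := @checkerboard_signed_inj 1 0 q p.
by rewrite expr1 mulN1r mul1r.
Qed.

(** * The subgroup of even residues and its complement *)

Hypothesis n_gt0 : (0 < n)%N.

Let v_gt1 : (1 < v)%N. Proof. by rewrite v_eq; nia. Qed.
Let v_even : ~~ odd v. Proof. by rewrite v_eq oddM. Qed.
Let ZpE : (Zp_trunc v).+2 = v. Proof. exact: Zp_cast. Qed.

(** This is the subgroup J: it has index 2, hence order v/2 = 2n^2. *)
Definition evens : {set 'Z_v} := [set x : 'Z_v | ~~ odd x].

(** Reduction modulo an even v preserves parity. *)
Lemma odd_Zp_add (x y : 'Z_v) : odd (x + y)%R = odd x (+) odd y.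
Proof. by rewrite /= odd_mod ?oddD // ZpE (negbTE v_even). Qed.

Lemma odd_Zp_opp (x : 'Z_v) : odd (- x)%R = odd x.
Proof. by have := odd_Zp_add x (- x); rewrite subrr /=; do 2!case: odd. Qed.

Lemma odd_Zp_natr m : odd (m%:R : 'Z_v) = odd m.
Proof. by rewrite val_Zp_nat // odd_mod // (negbTE v_even). Qed.

Lemma evens_group_set : group_set evens.
Proof.
apply/group_setP; split=> [|x y]; first by rewrite inE.
by rewrite !inE odd_Zp_add => /negbTE -> /negbTE ->.
Qed.

Lemma card_evensC : #|~: evens| = #|evens|.
Proof.
(* Translation by 1 is a bijection from the even residues onto the odd ones. *)
have <- : [set x + 1 | x in evens] = ~: evens.
  apply/setP => y; apply/imsetP/idP => [[x xE ->]|].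
    by move: xE; rewrite !inE odd_Zp_add (odd_Zp_natr 1) => /negbTE ->.
  rewrite !inE negbK => y_odd; exists (y - 1); last by rewrite subrK.
  by rewrite inE odd_Zp_add odd_Zp_opp (odd_Zp_natr 1) y_odd.
by rewrite card_imset //; apply: addIr.
Qed.

Lemma card_evens : #|evens| = (2 * n ^ 2)%N.
Proof.
have := cardsC evens; rewrite card_evensC => evens2.
have : (#|evens| + #|evens| = 4 * n ^ 2)%N.
  by rewrite evens2 -v_eq -[RHS]ZpE; apply: card_ord.
lia.
Qed.

Lemma checkerboard_odd i j : odd (checkerboard n v i j).
Proof.
rewrite mxE -signr_odd mulr_sign.
by case: (odd (i + j)); rewrite ?odd_Zp_opp odd_Zp_natr /= odd_double.
Qed.

(** By counting: the entries and their opposites are 2n^2 distinct odd residues, and there are only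
    2n^2 odd residues in all. *)
Lemma checkerboard_signed_entries :
  perm_eq (entries (checkerboard n v) ++
           [seq - x | x <- entries (checkerboard n v)])
          (enum (~: evens)).
Proof.
set s := _ ++ _.
have s_odd : {subset s <= enum (~: evens)}.
  move=> x; rewrite mem_enum !inE negbK mem_cat => /orP[].
    by case/mapP => p _ ->; apply: checkerboard_odd.
  case/mapP => _ /mapP[p _ ->] ->.
  by rewrite odd_Zp_opp checkerboard_odd.
have s_uniq : uniq s := checkerboard_signed_entries_uniq.
have [|_ s_mem] := uniq_min_size s_uniq s_odd; last first.
  exact: uniq_perm (enum_uniq _) s_mem.
have size_entries : size (entries (checkerboard n v)) = (n * n)%N.
  by rewrite size_map -cardE card_prod card_ord.
by rewrite -cardE card_evensC card_evens size_cat size_entries size_map size_entries; lia.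
Qed.

End Checkerboard.

Theorem proposition3p11 (n : nat) (n_odd : odd n) :
  exists A : 'M['Z_(heffter_modulus n (2 * n ^ 2))]_n,
    is_NH n (2 * n ^ 2) A /\ globally_simple A.
Proof.
have n_gt0 : (0 < n)%N by case: n n_odd.
have v_eq : heffter_modulus n (2 * n ^ 2) = (4 * n ^ 2)%N.
  by rewrite /heffter_modulus; lia.
exists (checkerboard n _); split; last exact: checkerboard_globally_simple.
split=> //; first by rewrite muln_gt0 expn_gt0 n_gt0.
exists (Group (evens_group_set v_eq n_gt0)); split.
- exact: card_evens.
- exact: checkerboard_signed_entries.
- exact: checkerboard_row_sum.
- exact: checkerboard_col_sum.
Qed.
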